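(* Let $K$ be a field, let $K_m$ be the complete graph with $m$ vertices, $m\ge3$, and let $J$ be the cover ideal of $K_m$ in the polynomial ring $R=K[x_1,\ldots,x_m]$. Then: (1) for all $n\ge1$, $$v(J^{(n)})=\begin{cases}\frac m2n+m-3&\text{if } n \text{ is even},\\[2pt] \frac m2n+\frac m2-2&\text{if } n\text{ is odd}.\end{cases}$$ (2) $v(J^{(n)})\le\operatorname{reg}(R/J^{(n)})=n(m-1)-1$ for all $n\ge1$. (3) $\operatorname{reg}(R/J^{(i)})=v(J^{(i)})$ for $i=1,2$.
   Context: The cover ideal of a finite simple graph $G$ with vertices $1,\ldots,m$ is $J(G)=\bigcap_{(i,j)\in E(G)}\langle x_i,x_j\rangle\subset R=K[x_1,\ldots,x_m]$, with $R$ standard graded. In the complete graph $K_m$ every two distinct vertices are adjacent. The $n$-th symbolic power is $J^{(n)}=\bigcap_{Q\in\operatorname{Ass}(R/J)}(J^nR_Q\cap R)$. For a homogeneous ideal $I$ of $R=\bigoplus_nR_n$, the $v$-number is $v(I)=\min\{u:\text{there exist } f\in R_u\text{ and }\mathfrak p\in\operatorname{Ass}(R/I)\text{ with }\mathfrak p=(I:f)\}$. For a finitely generated graded $R$-module $M$ with minimal graded free resolution having $i$-th term $\bigoplus_jR(-j)^{\beta_{ij}}$, the Castelnuovo–Mumford regularity is $\operatorname{reg}(M)=\max\{j-i:\beta_{ij}\ne0\}$. *)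

(* Defs.v *)
From HB Require Import structures.
From mathcomp Require Import all_boot all_order all_algebra.
From mathcomp Require Import mpoly.

Set Implicit Arguments.
Unset Strict Implicit.
Unset Printing Implicit Defensive.

Import Order.TTheory GRing.Theory Num.Theory.

Local Open Scope ring_scope.

(* Ideals of a commutative ring are handled as predicates [R -> Prop], so that
   no decidability of ideal membership is presupposed. *)
Section Ideals.

Variable R : comNzRingType.
Implicit Types (I J P Q S : R -> Prop) (f g : R).

Definition is_ideal I : Prop :=
  [/\ I 0, forall f g, I f -> I g -> I (f + g) & forall f g, I g -> I (f * g)].

Definition prime_ideal P : Prop :=
  [/\ is_ideal P, ~ P 1 & forall f g, P (f * g) -> P f \/ P g].

Definition gen_ideal S f : Prop :=
  exists (k : nat) (c s : 'I_k -> R),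
    (forall i, S (s i)) /\ f = \sum_(i < k) c i * s i.

Definition ideal_pow I (n : nat) : R -> Prop :=
  gen_ideal (fun f => exists g : 'I_n -> R,
    (forall i, I (g i)) /\ f = \prod_(i < n) g i).

Definition colon I f g : Prop := I (g * f).

Definition ideal_eq I J : Prop := forall f, I f <-> J f.

Definition Ass I P : Prop :=
  prime_ideal P /\ exists f, ideal_eq P (colon I f).

End Ideals.

Section Symbolic.

Variable R : idomainType.
Implicit Types (I Q : R -> Prop) (f : R).

(* Since [R] is a domain, R_Q and its ideals are realized inside the field of
   fractions of [R]. *)
Definition localization Q (x : {fraction R}) : Prop :=
  exists a s : R, ~ Q s /\ x = tofrac a / tofrac s.

Definition loc_extension I Q (x : {fraction R}) : Prop :=
  exists (k : nat) (c : 'I_k -> {fraction R}) (a : 'I_k -> R),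
    [/\ forall i, localization Q (c i), forall i, I (a i)
      & x = \sum_(i < k) c i * tofrac (a i)].

Definition symbolic_power I (n : nat) f : Prop :=
  forall Q, Ass I Q -> loc_extension (ideal_pow I n) Q (tofrac f).

End Symbolic.

Record sgraph (V : Type) := SGraph {
  adj :> rel V;
  adj_sym : ssrbool.symmetric adj;
  adj_irrefl : irreflexive adj
}.

Definition complete_rel (m : nat) : rel 'I_m := fun i j => i != j.

Lemma complete_rel_sym m : ssrbool.symmetric (@complete_rel m).
Proof. by move=> i j; rewrite /complete_rel eq_sym. Qed.

Lemma complete_rel_irrefl m : irreflexive (@complete_rel m).
Proof. by move=> i; rewrite /complete_rel eqxx. Qed.

Definition complete_graph (m : nat) : sgraph 'I_m :=
  SGraph (@complete_rel_sym m) (@complete_rel_irrefl m).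

Section PolynomialIdeals.

Variables (K : fieldType) (m : nat).
Local Notation R := {mpoly K[m]}.
Implicit Type I : R -> Prop.

Definition cover_ideal (G : sgraph 'I_m) : R -> Prop :=
  fun f => forall i j : 'I_m, G i j ->
    gen_ideal (fun g : R => g = 'X_i \/ g = 'X_j) f.

Definition irrelevant_ideal : R -> Prop :=
  gen_ideal (fun g : R => exists i : 'I_m, g = 'X_i).

Definition v_witness I (u : nat) : Prop :=
  exists f : R, f \is u.-homog /\
    exists P : R -> Prop, Ass I P /\ ideal_eq P (colon I f).

Definition is_vnumber I (u : nat) : Prop :=
  v_witness I u /\ forall w, v_witness I w -> (u <= w)%N.

Definition homog_of_degree (d : int) (p : R) : Prop :=
  p = 0 \/ exists2 e : nat, d = e%:Z & p \is e.-homog.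

(* Data of a sequence ... -> F_2 -> F_1 -> F_0 -> R/I of graded free modules
   F_i = (+)_k R(- shift i k) of finite rank. Elements of F_i are row vectors,
   and [diff i] is the matrix of F_{i+1} -> F_i acting by right multiplication.
   [aug] lists representatives in R of the images in R/I of the basis of F_0. *)
Record free_seq := FreeSeq {
  rk : nat -> nat;
  shift : forall i, 'I_(rk i) -> int;
  diff : forall i, 'M[R]_(rk i.+1, rk i);
  aug : 'cV[R]_(rk 0)
}.

Definition graded_maps (F : free_seq) : Prop :=
  (forall l, homog_of_degree (shift l) (aug F l 0)) /\
  (forall i k l, homog_of_degree (shift k - shift l) (diff F i k l)).

Definition exact_onto_quotient (F : free_seq) I : Prop :=
  [/\ forall r : R, exists v : 'rV[R]_(rk F 0), I (r - (v *m aug F) 0 0),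
      forall v : 'rV[R]_(rk F 0),
        I ((v *m aug F) 0 0) <-> exists w, v = w *m diff F 0
    & forall i (v : 'rV[R]_(rk F i.+1)),
        v *m diff F i = 0 <-> exists w, v = w *m diff F i.+1].

Definition minimal_maps (F : free_seq) : Prop :=
  forall i k l, irrelevant_ideal (diff F i k l).

Definition min_graded_free_resolution (F : free_seq) I : Prop :=
  [/\ graded_maps F, exact_onto_quotient F I & minimal_maps F].

Definition betti (F : free_seq) (i : nat) (j : int) : nat :=
  #|[set k : 'I_(rk F i) | shift k == j]|.

(* [r] is the Castelnuovo-Mumford regularity of R/I. Minimal graded free
   resolutions are unique up to isomorphism, so the choice of [F] is
   irrelevant. *)
Definition is_regularity_quot I (r : int) : Prop :=
  exists F : free_seq, min_graded_free_resolution F I /\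
    (exists (i : nat) (j : int), betti F i j <> 0%N /\ j - i%:Z = r) /\
    (forall (i : nat) (j : int), betti F i j <> 0%N -> j - i%:Z <= r).

End PolynomialIdeals.

(* Main.v *)
Require Import Defs.
From HB Require Import structures.
From mathcomp Require Import all_boot all_order all_algebra.
From mathcomp Require Import mpoly zify ring.

Set Implicit Arguments.
Unset Strict Implicit.
Unset Printing Implicit Defensive.

Import Order.TTheory GRing.Theory Num.Theory.

Local Open Scope ring_scope.

(* J^(n) is spanned by the monomials x^u with u_i + u_j >= n for all i <> j.

   If (J^(n) : f) is prime, it is some (x_i, x_j), and a suitable monomial x^u
   of f satisfies u_i + u_j = n - 1 and u_k >= n - min(u_i, u_j) for the other
   k; minimizing the degree of u gives the v-number.

   J^(n) is generated by the monomials x_i^t \prod_(k <> i) x_k^(n - t) with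
   2 t <= n.  Listed by increasing t, each generator g but the last has
   (later generators : g) = (x_i), through a two-term relation x_i g = d g'
   with g' a later generator.  These relations are the edges of a tree on the
   generators, so they form a triangular matrix and give a minimal resolution
   of length two; the generators of largest degree n (m - 1), those with t = 0,
   determine the regularity. *)

(** * Ideals and their powers in a commutative ring *)

Section Ideals.

Variable R : comNzRingType.
Implicit Types (I Q S : R -> Prop).

Lemma ideal_sum I (T : Type) (r : seq T) (F : T -> R) :
  is_ideal I -> (forall t, I (F t)) -> I (\sum_(t <- r) F t).
Proof. by case=> I0 ID _ IF; elim/big_rec: _ => // t x _; apply: ID. Qed.

Lemma gen_ideal_gen S g : S g -> gen_ideal S g.
Proof.
move=> Sg; exists 1%N, (fun=> 1), (fun=> g); split=> //.
by rewrite big_ord1 mul1r.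
Qed.

Lemma gen_ideal_is_ideal S : is_ideal (gen_ideal S).
Proof.
split.
- by exists 0%N, (fun=> 0), (fun=> 0); split=> [[]|] //; rewrite big_ord0.
- move=> f g [k [c [s [Ss ->]]]] [l [d [t [St ->]]]].
  exists (k + l)%N, (fun i => match split i with inl j => c j | inr j => d j end).
  exists (fun i => match split i with inl j => s j | inr j => t j end).
  split=> [i|]; first by case: (split i).
  rewrite big_split_ord; congr (_ + _); apply: eq_bigr => i _.
    by rewrite -[lshift l i]/(unsplit (inl i)) unsplitK.
  by rewrite -[rshift k i]/(unsplit (inr i)) unsplitK.
- move=> f g [k [c [s [Ss ->]]]]; exists k, (fun i => f * c i), s; split=> //.
  by rewrite mulr_sumr; apply: eq_bigr => i _; rewrite mulrA.
Qed.

Lemma gen_ideal_min S Q f :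
  is_ideal Q -> (forall g, S g -> Q g) -> gen_ideal S f -> Q f.
Proof.
move=> Qid SQ [k [c [s [Ss ->]]]]; apply: ideal_sum => // i.
by case: Qid => _ _; apply; apply: SQ.
Qed.

Lemma colon_is_ideal I f : is_ideal I -> is_ideal (colon I f).
Proof.
rewrite /colon => -[I0 ID IM]; split=> [|g h Ig Ih|g h Ih].
- by rewrite mul0r.
- by rewrite mulrDl; apply: ID.
- by rewrite -mulrA; apply: IM.
Qed.

Lemma prime_ideal_prod Q (T : finType) (F : T -> R) :
  prime_ideal Q -> (forall t, ~ Q (F t)) -> ~ Q (\prod_t F t).
Proof.
by case=> _ Q1 QM QF; elim/big_rec: _ => // t x _ Qx /QM[/QF|].
Qed.

Lemma prime_ideal_exp Q x n : prime_ideal Q -> ~ Q x -> ~ Q (x ^+ n).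
Proof.
case=> _ Q1 QM Qx; elim: n => [|n IHn]; rewrite ?expr0 ?exprS //.
by move/QM => [/Qx|/IHn].
Qed.

Lemma ideal_pow0 I f : ideal_pow I 0 f.
Proof.
exists 1%N, (fun=> f), (fun=> 1); split=> [_|]; last by rewrite big_ord1 mulr1.
by exists (fun=> 0); split=> [[]|] //; rewrite big_ord0.
Qed.

Lemma ideal_powS I n f g :
  I f -> ideal_pow I n g -> ideal_pow I n.+1 (f * g).
Proof.
move=> If [k [c [s [Is ->]]]]; exists k, c, (fun t => f * s t); split=> [t|].
  have [h [Ih ->]] := Is t.
  exists (fun l => if unlift ord0 l is Some l' then h l' else f); split=> [l|].
    by case: (unlift ord0 l).
  rewrite big_ord_recl unlift_none; congr (_ * _).
  by apply: eq_bigr => l _; rewrite liftK.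
by rewrite mulr_sumr; apply: eq_bigr => t _; rewrite mulrCA.
Qed.

End Ideals.

(** * Powers of primes generated by variables *)

Section VariablePowers.

Variables (K : fieldType) (m : nat).
Local Notation R := {mpoly K[m]}.
Implicit Types (A : {set 'I_m}) (u : 'X_{1..m}) (f g p q s : R).

Definition wt A u : nat := (\sum_(k in A) u k)%N.

(* Membership in the [n]-th power of the monomial prime ideal generated by the
   variables indexed by [A]. *)
Definition var_pow A n : pred R := fun f => all (fun u => n <= wt A u)%N (msupp f).

Lemma wtD A u w : wt A (u + w)%MM = (wt A u + wt A w)%N.
Proof. by rewrite /wt -big_split; apply: eq_bigr => k _; rewrite mnmDE. Qed.

Lemma wt0 A : wt A 0%MM = 0%N.
Proof. by rewrite /wt big1 // => k _; rewrite mnm0E. Qed.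

Lemma wt1 k u : wt [set k] u = u k.
Proof. by rewrite /wt big_set1. Qed.

Lemma wt2 i j u : i != j -> wt [set i; j] u = (u i + u j)%N.
Proof. by move=> ij; rewrite /wt big_setU1 ?inE // big_set1. Qed.

Lemma ideal_msupp (Q : R -> Prop) f :
  is_ideal Q -> (forall u, u \in msupp f -> Q 'X_[u]) -> Q f.
Proof.
move=> [Q0 QD QM] Qu; rewrite [f]mpolyE big_seq.
elim/big_rec: _ => // u x /Qu Qx Qf; apply: QD => //.
by rewrite -mul_mpolyC; apply: QM.
Qed.

Lemma var_powP {A n f} :
  reflect (forall u, u \in msupp f -> n <= wt A u)%N (var_pow A n f).
Proof. exact: allP. Qed.

Lemma var_powX A n u : var_pow A n 'X_[u] = (n <= wt A u)%N.
Proof. by rewrite /var_pow msuppX /= andbT. Qed.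

Lemma var_powMX A n f u : var_pow A n (f * 'X_[u]) = var_pow A (n - wt A u) f.
Proof.
rewrite /var_pow (perm_all _ (msuppMX f u)) all_map; apply: eq_all => w /=.
by rewrite wtD leq_subLR.
Qed.

Lemma var_pow0 A f : var_pow A 0 f.
Proof. exact/allP. Qed.

Lemma var_powW A n k f : (k <= n)%N -> var_pow A n f -> var_pow A k f.
Proof. by move=> kn /var_powP fn; apply/var_powP => u /fn; apply: leq_trans. Qed.

Lemma var_powD A n f g : var_pow A n f -> var_pow A n g -> var_pow A n (f + g).
Proof.
move=> /var_powP fn /var_powP gn; apply/var_powP => u /msuppD_le.
by rewrite mem_cat => /orP[/fn|/gn].
Qed.

Lemma var_powM A n k f g :
  var_pow A n f -> var_pow A k g -> var_pow A (n + k) (f * g).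
Proof.
move=> /var_powP fn /var_powP gk; apply/var_powP => u /msuppM_le.
by case/allpairsP => -[v w] /= [/fn vn /gk wk ->]; rewrite wtD leq_add.
Qed.

Lemma var_powN A n f : var_pow A n (- f) = var_pow A n f.
Proof. by rewrite /var_pow (perm_all _ (msuppN f)). Qed.

Lemma var_pow_is_ideal A n : is_ideal (var_pow A n).
Proof.
split=> [|f g|f g]; first by rewrite /var_pow msupp0.
  exact: var_powD.
by move/(var_powM (var_pow0 A f)).
Qed.

Lemma var_pow_one A f : var_pow A 1 f ->
  forall Q : R -> Prop, is_ideal Q -> (forall k, k \in A -> Q 'X_k) -> Q f.
Proof.
move=> /var_powP f1 Q Qid QA; apply: ideal_msupp => // u /f1.
rewrite /wt lt0n sum_nat_eq0 negb_forall => /existsP[k].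
rewrite negb_imply => /andP[kA uk].
have ku : (U_(k) <= u)%MM by rewrite lep1mP.
by rewrite -(submK ku) mpolyXD; case: Qid => _ _; apply; apply: QA.
Qed.

(** Powers of such a prime are primary: in the grading by [wt A], the weight-0 part of [s] times the
    lowest part of [f] is the lowest part of [s * f], nonzero in a domain. The induction raises the
    order of [f] by one each time. *)
Lemma var_pow_primary A n s f :
  ~~ var_pow A 1 s -> var_pow A n (s * f) -> var_pow A n f.
Proof.
move=> sA; elim: n => [_|n IHn sf]; first exact: var_pow0.
have fn : var_pow A n f by apply: IHn; apply: var_powW sf.
pose part k g : R := \sum_(u <- msupp g | wt A u == k) g@_u *: 'X_[u].
have coef_part k g u : (part k g)@_u = if wt A u == k then g@_u else 0.
  rewrite /part linear_sum /= big_mkcond /=.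
  have [ug|ug] := boolP (u \in msupp g); last first.
    rewrite (memN_msupp_eq0 ug) if_same big_seq big1 // => w wg.
    case: ifP => // _; rewrite mcoeffZ mcoeffX.
    by case: eqP wg ug => [->|_] => [->//|]; rewrite mulr0.
  rewrite (bigD1_seq u) ?msupp_uniq //= big1 ?addr0 => [|w wu].
    by case: ifP => // _; rewrite mcoeffZ mcoeffX eqxx mulr1.
  by case: ifP => // _; rewrite mcoeffZ mcoeffX (negbTE wu) mulr0.
have part_wt k g u : u \in msupp (part k g) -> wt A u = k.
  by rewrite mcoeff_msupp coef_part; case: (wt A u =P k) => // _; rewrite eqxx.
have rest_wt k g : var_pow A k g -> var_pow A k.+1 (g - part k g).
  move=> /var_powP gk; apply/var_powP => u; rewrite mcoeff_msupp mcoeffB coef_part.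
  case: (wt A u =P k) => [_|]; rewrite ?subrr ?eqxx // subr0 -mcoeff_msupp => ne /gk.
  by lia.
have s0 : part 0%N s != 0.
  apply: contra sA => /eqP s0; have := rest_wt _ _ (var_pow0 A s).
  by rewrite s0 subr0.
(* Modulo weight above [n] this product equals [s * f], itself of weight above [n]. Being
   homogeneous of weight [n], it must vanish. *)
have : var_pow A n.+1 (part 0%N s * part n f).
  have -> : part 0%N s * part n f =
      s * f - ((s - part 0%N s) * f + part 0%N s * (f - part n f)) by ring.
  apply: var_powD => //; rewrite var_powN; apply: var_powD.
    by rewrite -add1n; apply: var_powM => //; apply: rest_wt; apply: var_pow0.
  by apply: (@var_powM A 0); [apply: var_pow0 | apply: rest_wt].
move=> /var_powP sfn; have : part 0%N s * part n f = 0.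
  apply/eqP; rewrite -msupp_eq0; case E: msupp => [//|u l].
  have us : u \in msupp (part 0%N s * part n f) by rewrite E mem_head.
  have := sfn u us.
  have /allpairsP[[v w] /= [/part_wt v0 /part_wt wn ->]] := msuppM_le us.
  by rewrite wtD v0 wn ltnn.
move/eqP; rewrite mulf_eq0 (negbTE s0) /= => /eqP f0.
by have := rest_wt _ _ fn; rewrite f0 subr0.
Qed.

Lemma var_pow_prime A : prime_ideal (var_pow A 1).
Proof.
split=> [||f g fg]; first exact: var_pow_is_ideal.
  by move/var_powP => /(_ 0%MM); rewrite msupp1 mem_seq1 eqxx wt0 => /(_ isT).
have [|fA] := boolP (var_pow A 1 f); first by left.
by right; apply: var_pow_primary fA fg.
Qed.

End VariablePowers.

(** * Clearing denominators in a localization *)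

Section Localization.

Variable R : idomainType.

Lemma loc_extension_numerator (I Q : R -> Prop) (f : R) :
  is_ideal I -> prime_ideal Q -> loc_extension I Q (tofrac f) ->
  exists2 s, ~ Q s & I (s * f).
Proof.
case=> I0 ID IM Qpr [k [c [a [cQ aI fE]]]]; have [[Q0 _ _] Q1 QM] := Qpr.
have QMN s t : ~ Q s -> ~ Q t -> ~ Q (s * t) by move=> sQ tQ /QM[].
have nz s : ~ Q s -> tofrac s != 0.
  by move=> sQ; rewrite tofrac_eq0; apply/eqP => s0; apply: sQ; rewrite s0.
suff [s [b [sQ bI sb]]] :
    exists s b, [/\ ~ Q s, I b & tofrac f * tofrac s = tofrac b].
  exists s => //; rewrite mulrC; suff -> : f * s = b by [].
  by apply/eqP; rewrite -tofrac_eq rmorphM /= sb.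
rewrite fE; elim/big_rec: _ => [|i x _ [s [b [sQ bI sb]]]].
  by exists 1, 0; rewrite rmorph1 mul0r rmorph0.
have [d [t [tQ ->]]] := cQ i; exists (t * s), (d * s * a i + t * b).
split; [exact: QMN | by apply: ID; apply: IM|].
rewrite rmorphD !rmorphM /= -sb; field; exact: nz.
Qed.

End Localization.

(** * Symbolic powers of the cover ideal of a complete graph *)

Section SymbolicPower.

Variables (K : fieldType) (m : nat).
Local Notation R := {mpoly K[m]}.
Implicit Types (i j k p q : 'I_m) (u a : 'X_{1..m}) (f g : R) (Q : R -> Prop).

(** Explicit form of the symbolic power, as an intersection of powers of pair primes. Being boolean,
    it allows case analysis on membership. *)
Definition sym_pow n : pred R :=
  fun f => [forall i, forall j, (i != j) ==> var_pow [set i; j] n f].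

Lemma sym_powP {n f} :
  reflect (forall i j, i != j -> var_pow [set i; j] n f) (sym_pow n f).
Proof.
apply: (iffP forallP) => [fn i j ij|fn i]; last first.
  by apply/forallP => j; apply/implyP/fn.
by have /forallP/(_ j)/implyP := fn i; apply.
Qed.

Lemma sym_pow_is_ideal n : is_ideal (sym_pow n).
Proof.
split=> [|f g /sym_powP fn /sym_powP gn|f g /sym_powP gn]; apply/sym_powP => i j ij;
  have [Z D M] := var_pow_is_ideal K [set i; j] n.
- exact: Z.
- by apply: D; [apply: fn | apply: gn].
- by apply: M; apply: gn.
Qed.

Lemma sym_pow_msupp n f u : sym_pow n f -> u \in msupp f -> sym_pow n 'X_[u].
Proof.
move=> /sym_powP fn uf; apply/sym_powP => i j ij; rewrite var_powX.
by have /var_powP := fn _ _ ij; apply.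
Qed.

Lemma sym_powX n u :
  sym_pow n ('X_[u] : R) <-> forall i j, i != j -> (n <= u i + u j)%N.
Proof.
split=> [/sym_powP un i j ij|un]; last first.
  by apply/sym_powP => i j ij; rewrite var_powX wt2 // un.
by have := un i j ij; rewrite var_powX wt2.
Qed.

Lemma set2_pair i j p q : 
  p != q -> [set p; q] != [set i; j] ->
  (p \notin [set i; j]) || (q \notin [set i; j]).
Proof.
move=> pq; apply: contraR; rewrite negb_or !negbK => /andP[pij qij].
rewrite eqEcard subUset !sub1set pij qij /= !cards2 pq.
by case: (i != j).
Qed.

(** The monomial falls short on the pair [i, j] alone, and by exactly one. Such monomials yield both
    the associated primes of the cover ideal and the witness for the v-number. *)
Lemma sym_pow_colonX n a i j :
  i != j -> (wt [set i; j] a).+1 = n ->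
  (forall p q, p != q -> [set p; q] != [set i; j] -> n <= a p + a q)%N ->
  ideal_eq (var_pow [set i; j] 1) (colon (sym_pow n) ('X_[a] : R)).
Proof.
move=> ij an apq f; rewrite /colon; split=> [f1|/sym_powP/(_ i j ij)]; last first.
  by rewrite var_powMX -an subSnn.
apply/sym_powP => p q pq; rewrite var_powMX.
have [->|ne] := eqVneq [set p; q] [set i; j]; first by rewrite -an subSnn.
have /eqP-> : (n - wt [set p; q] a == 0)%N by rewrite subn_eq0 wt2 // apq.
exact: var_pow0.
Qed.

(* If no pair [{i, j}] with [f] outside [(x_i, x_j)^n] had both variables in
   [Q], the product of the [n]-th powers of all variables outside [Q] would
   lie in the colon ideal [Q]. *)
Lemma sym_pow_prime_colon n f Q :
  prime_ideal Q -> ideal_eq Q (colon (sym_pow n) f) ->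
  exists i j, i != j /\ ideal_eq Q (var_pow [set i; j] 1).
Proof.
move=> Qpr Qf; have [Qid Q1 QM] := Qpr.
pose a := [multinom (if sym_pow n ('X_k * f)%R then 0 else n)%N | k < m].
pose good := [exists i, exists j, [&& i != j, ~~ var_pow [set i; j] n f,
  sym_pow n ('X_i * f) & sym_pow n ('X_j * f)]].
have : good.
  apply: contraT => ngood; suff: Q 'X_[a].
    move=> Qa; exfalso; move: Qa; rewrite mpolyXE_id.
    apply: prime_ideal_prod => // k; rewrite mnmE.
    have [_|kf] := boolP (sym_pow _ _); first by rewrite expr0.
    by apply: prime_ideal_exp => // /Qf; rewrite /colon (negbTE kf).
  apply/Qf/sym_powP => i j ij.
  have [fn|nfn] := boolP (var_pow [set i; j] n f).
    by rewrite -[n]add0n; apply: var_powM fn; apply: var_pow0.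
  rewrite mulrC var_powMX wt2 // !mnmE.
  move: ngood; rewrite /good negb_exists => /forallP/(_ i).
  rewrite negb_exists => /forallP/(_ j); rewrite ij nfn /=.
  case: (sym_pow n ('X_i * f)) => /= [/negbTE->|_];
    rewrite ?add0n ?subnn ?var_pow0 //.
  by rewrite subnDA subnn sub0n var_pow0.
case/existsP=> i /existsP[j /and4P[ij nfn fi fj]]; exists i, j; split=> // g.
split=> [/Qf/sym_powP/(_ i j ij)|/var_pow_one]; last first.
  apply=> // k; rewrite !inE => /orP[]/eqP->; exact/Qf.
have [//|g1] := boolP (var_pow [set i; j] 1 g).
by move/(var_pow_primary g1); rewrite (negbTE nfn).
Qed.

Lemma cover_ideal_complete f : cover_ideal (complete_graph m) f <-> sym_pow 1 f.
Proof.
split=> [Jf|/sym_powP f1 i j ij].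
  apply/sym_powP => i j ij; have := Jf i j ij.
  apply: (gen_ideal_min (var_pow_is_ideal K [set i; j] 1)).
  by move=> g [] ->; rewrite var_powX wt2 // !mnm1E eqxx ?addn1 ?add1n.
apply: (var_pow_one (f1 i j ij)); first exact: gen_ideal_is_ideal.
by move=> k; rewrite !inE => /orP[]/eqP->; apply: gen_ideal_gen; [left|right].
Qed.

Lemma Ass_cover_ideal Q : Ass (cover_ideal (complete_graph m)) Q <->
  exists i j, i != j /\ ideal_eq Q (var_pow [set i; j] 1).
Proof.
split=> [[Qpr [f Qf]]|[i [j [ij Qij]]]].
  apply: (sym_pow_prime_colon (n := 1) (f := f)) => // g.
  by split=> [/Qf/cover_ideal_complete|] // gf; apply/Qf/cover_ideal_complete.
split.
  have [[Z D M] P1 PM] := var_pow_prime K [set i; j]; split.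
  - split=> [|f g /Qij fQ /Qij gQ|f g /Qij gQ]; apply/Qij => //.
      exact: D.
    exact: M.
  - by move/Qij.
  - by move=> f g /Qij/PM[]/Qij; [left|right].
(* The product of all variables but ['X_i] and ['X_j] has weight 0 on this pair and at least 1 on
   every other. *)
pose a := [multinom nat_of_bool (k \notin [set i; j]) | k < m].
exists 'X_[a] => g; apply: (iff_trans (Qij g)).
have := @sym_pow_colonX 1 a i j ij; rewrite wt2 // !mnmE !inE !eqxx orbT.
move=> /(_ erefl) H; apply: (iff_trans (H _ g)).
  move=> p q pq ne; rewrite !mnmE; have := set2_pair pq ne.
  by do 2!case: (_ \notin _).
by split=> /cover_ideal_complete.
Qed.

Lemma var_pow_sym_pow_exp n i j f :
  i != j -> ideal_pow (sym_pow 1) n f -> var_pow [set i; j] n f.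
Proof.
move=> ij; apply: (gen_ideal_min (var_pow_is_ideal K [set i; j] n)).
move=> _ [h [h1 ->]]; elim: n h h1 => [|n IHn] h h1; first exact: var_pow0.
rewrite big_ord_recl; apply: (@var_powM _ _ _ 1 n); last exact: IHn.
by have /sym_powP := h1 ord0; apply.
Qed.

(** The product of the variables outside the pair multiplies ['X_i] and ['X_j] into the cover ideal
    and is a unit after localizing at the pair prime. Hence the localized [n]-th power of the cover
    ideal contains that of the prime. *)
Lemma mulX_sym_pow_exp n i j f :
  i != j -> var_pow [set i; j] n f ->
  ideal_pow (sym_pow 1) n
    (f * 'X_[[multinom nat_of_bool (k \notin [set i; j]) | k < m]] ^+ n).
Proof.
set a := [multinom _ | k < m] => ij /var_powP fn.
have XJ k : k \in [set i; j] -> sym_pow 1 ('X_k * 'X_[a] : R).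
  move=> kij; apply/sym_powP => p q pq.
  rewrite -mpolyXD var_powX wt2 // !mnmDE !mnmE !addn_gt0 !lt0b.
  have [e|] := eqVneq [set p; q] [set i; j].
    by move: kij; rewrite -e !inE => /orP[]/eqP->; rewrite !eqxx ?orbT.
  by move/(set2_pair pq)/orP=> []->; rewrite !orbT.
have Qid : is_ideal (colon (ideal_pow (sym_pow 1) n) ('X_[a] ^+ n : R)).
  exact/colon_is_ideal/gen_ideal_is_ideal.
apply: (ideal_msupp Qid) => u /fn.
rewrite /colon wt2 //; elim: n {fn f Qid} u => [|n IHn] u un.
  exact: ideal_pow0.
(* One variable of the pair is split off from [u] and matched with one factor ['X_[a]]. *)
have [k kij uk] : exists2 k, k \in [set i; j] & (0 < u k)%N.
  have [ui|ui] := posnP (u i); last by exists i; rewrite ?inE ?eqxx.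
  by exists j; rewrite ?inE ?eqxx ?orbT //; lia.
have ku : (U_(k) <= u)%MM by rewrite lep1mP -lt0n.
rewrite -(submK ku) mpolyXD exprS.
have -> : 'X_[u - U_(k)] * 'X_k * ('X_[a] * 'X_[a] ^+ n) =
    'X_k * 'X_[a] * ('X_[u - U_(k)] * 'X_[a] ^+ n) :> R by ring.
apply: ideal_powS; first exact: XJ.
apply: IHn; rewrite !mnmBE !mnm1E.
move: kij uk un; rewrite !inE => /orP[]/eqP->;
  rewrite eqxx ?(negbTE ij) ?[j == i]eq_sym ?(negbTE ij); lia.
Qed.

(** At a pair prime, the localized [n]-th powers of the cover ideal and of the prime agree; the
    latter contracts to [var_pow] because it is primary. *)
Lemma symbolic_power_complete n f :
  symbolic_power (cover_ideal (complete_graph m)) n f <-> sym_pow n f.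
Proof.
have powE g : ideal_pow (cover_ideal (complete_graph m)) n g <->
              ideal_pow (sym_pow 1) n g.
  split; apply: gen_ideal_min; try exact: gen_ideal_is_ideal;
    move=> _ [h [hJ ->]]; apply: gen_ideal_gen; exists h; split=> // l;
    exact/cover_ideal_complete.
split=> [fn|/sym_powP fn Q /Ass_cover_ideal[i [j [ij Qij]]]].
  apply/sym_powP => i j ij; set Q := (fun g : R => is_true (var_pow [set i; j] 1 g)).
  have /fn AQ : Ass (cover_ideal (complete_graph m)) Q.
    by apply/Ass_cover_ideal; exists i, j.
  have [s sQ /powE sf] := loc_extension_numerator
    (gen_ideal_is_ideal _) (var_pow_prime K [set i; j]) AQ.
  by apply: (var_pow_primary (s := s)); [apply/negP | apply: var_pow_sym_pow_exp].
pose a := [multinom nat_of_bool (k \notin [set i; j]) | k < m].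
have sQ : ~ Q ('X_[a] ^+ n).
  move/Qij; apply: (prime_ideal_exp (var_pow_prime K [set i; j])).
  by rewrite var_powX wt2 // !mnmE !inE !eqxx orbT.
exists 1%N, (fun=> tofrac 1 / tofrac ('X_[a] ^+ n)), (fun=> f * 'X_[a] ^+ n).
split=> [_|_|]; first by exists 1, ('X_[a] ^+ n).
  exact/powE/mulX_sym_pow_exp/fn.
rewrite big_ord1 rmorph1 mul1r rmorphM mulrC mulfK //.
rewrite tofrac_eq0; apply/eqP => s0; apply: sQ; rewrite s0; apply/Qij.
by case: (var_pow_is_ideal K [set i; j] 1).
Qed.

End SymbolicPower.

(** * The v-number as a minimal monomial degree *)

Section VNumber.

Variables (K : fieldType) (m : nat).
Local Notation R := {mpoly K[m]}.

(** Least degree of a witness: [n.-1] on the pair, whose smaller exponent is then at most [n.-1./2],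
    so at least [n - n.-1./2] on each of the other [m - 2] variables. *)
Definition vnum (n : nat) : nat := (n.-1 + (m - 2) * (n - n.-1./2))%N.

Lemma mdeg_pair (i j : 'I_m) (u : 'X_{1..m}) : i != j ->
  mdeg u = (u i + u j + \sum_(k in ~: [set i; j]) u k)%N.
Proof.
move=> ij; rewrite mdegE (bigID (mem [set i; j])) /= -wt2 //; congr addn.
by apply: eq_bigl => k; rewrite in_setC.
Qed.

Lemma card_pairC (i j : 'I_m) : i != j -> #|~: [set i; j]| = (m - 2)%N.
Proof. by move=> ij; have := cardsC [set i; j]; rewrite cards2 ij card_ord; lia. Qed.

Lemma vnum_le_mdeg n (i j : 'I_m) (u : 'X_{1..m}) : i != j ->
  (u i + u j)%N = n.-1 ->
  (forall k, k \in ~: [set i; j] -> n <= u i + u k /\ n <= u j + u k)%N ->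
  (vnum n <= mdeg u)%N.
Proof.
move=> ij uij uk; rewrite (mdeg_pair u ij) uij leq_add2l.
rewrite -(card_pairC ij) -sum_nat_const.
by apply: leq_sum => k /uk; lia.
Qed.

Lemma v_witness_ge (I : R -> Prop) n w : (forall f, I f <-> sym_pow n f) ->
  v_witness I w -> (vnum n <= w)%N.
Proof.
move=> IE [f [/dhomogP fw [Q [[Qpr _] Qf]]]].
have Qf' : ideal_eq Q (colon (sym_pow n) f).
  by move=> g; split=> [/Qf/IE|] // gf; apply/Qf/IE.
have [i [j [ij Qij]]] := sym_pow_prime_colon Qpr Qf'.
have fi : sym_pow n ('X_i * f) by apply/Qf'/Qij; rewrite var_powX wt2 // !mnm1E eqxx.
have fj : sym_pow n ('X_j * f).
  by apply/Qf'/Qij; rewrite var_powX wt2 // !mnm1E eqxx addnC.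
have nf : ~~ sym_pow n f.
  apply/negP => fn; have [_ Q1 _] := Qpr; apply/Q1/Qf'.
  by rewrite /colon mul1r.
have [u uf nu] : exists2 u, u \in msupp f & ~~ sym_pow n ('X_[u] : R).
  apply/hasP; apply: contraR nf; rewrite -all_predC => /allP un.
  apply/sym_powP => p q pq; apply/var_powP => u /un /=; rewrite negbK => /sym_powX.
  by move=> un'; rewrite wt2 // un'.
rewrite -(fw u uf).
have supp k : (U_(k) + u)%MM \in msupp ('X_k * f).
  by rewrite mulrC (perm_mem (msuppMX _ _)) map_f.
have ui := sym_pow_msupp fi (supp i); have uj := sym_pow_msupp fj (supp j).
move/sym_powX in ui; move/sym_powX in uj.
(* The pairs [i, k] and [j, k] are read off ['X_j * f] and ['X_i * f], whose extra variable lies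
   outside the pair. *)
have uk k : k \in ~: [set i; j] -> (n <= u i + u k)%N /\ (n <= u j + u k)%N.
  rewrite !inE negb_or => /andP[ki kj]; split.
    have := uj i k; rewrite !mnmDE !mnm1E eq_sym ki => /(_ isT).
    by rewrite [j == i]eq_sym (negbTE ij) [j == k]eq_sym (negbTE kj).
  have := ui j k; rewrite !mnmDE !mnm1E eq_sym kj => /(_ isT).
  by rewrite (negbTE ij) [i == k]eq_sym (negbTE ki).
apply: (vnum_le_mdeg ij) => //.
have uij : (n <= (u i + u j).+1)%N.
  have := ui i j ij; rewrite !mnmDE !mnm1E eqxx (negbTE ij); lia.
(* If the sum on [i, j] reached [n], then [u] would meet every pair condition, against its
   choice. *)
suff : ~~ (n <= u i + u j)%N by lia.
apply: contra nu => nuij; apply/sym_powX => p q pq.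
have [e|] := eqVneq [set p; q] [set i; j].
  by rewrite -wt2 // e wt2.
(* One member of the pair lies outside [i, j] and the other equals at most one of them; multiplying
   by the remaining one of ['X_i] and ['X_j] leaves both exponents unchanged. *)
move/(set2_pair pq); rewrite !inE !negb_or => /orP[/andP[pi pj]|/andP[qi qj]].
  have := ui p q pq; have := uj p q pq; rewrite !mnmDE !mnm1E ![_ == p]eq_sym.
  rewrite (negbTE pi) (negbTE pj).
  case: (eqVneq i q) => [<-|_]; last by lia.
  by rewrite eq_sym (negbTE ij) => /[swap]; lia.
have := ui p q pq; have := uj p q pq; rewrite !mnmDE !mnm1E ![_ == q]eq_sym.
rewrite (negbTE qi) (negbTE qj).
case: (eqVneq i p) => [<-|_]; last by lia.
by rewrite eq_sym (negbTE ij) => /[swap]; lia.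
Qed.

Lemma v_witness_vnum (I : R -> Prop) n : (2 <= m)%N -> (0 < n)%N ->
  (forall f, I f <-> sym_pow n f) -> v_witness I (vnum n).
Proof.
move=> m2 n0 IE; pose i : 'I_m := Ordinal (ltnW m2); pose j : 'I_m := Ordinal m2.
(* The total [n.-1] is split as evenly as possible over [i] and [j]; every other exponent takes the
   least value this allows. *)
pose a := [multinom if k == i then n.-1./2 else
  if k == j then n.-1 - n.-1./2 else n - n.-1./2 | k < m]%N.
have ij : i != j by [].
have ai : a i = n.-1./2 by rewrite mnmE eqxx.
have aj : a j = (n.-1 - n.-1./2)%N by rewrite mnmE eq_sym (negbTE ij) eqxx.
have ak k : k \notin [set i; j] -> a k = (n - n.-1./2)%N.
  by rewrite !inE negb_or mnmE => /andP[/negbTE-> /negbTE->].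
have aij : (wt [set i; j] a).+1 = n by rewrite wt2 // ai aj; lia.
have a_ge k : (n.-1./2 <= a k)%N by rewrite mnmE; case: eqP => // _; case: eqP; lia.
have apq p q : p != q -> [set p; q] != [set i; j] -> (n <= a p + a q)%N.
  move=> pq ne; have := a_ge p; have := a_ge q; move: (set2_pair pq ne).
  by case/orP=> /ak ->; lia.
have colona := sym_pow_colonX (K := K) ij aij apq.
have Qa : ideal_eq (var_pow [set i; j] 1) (colon I ('X_[a] : R)).
  by move=> g; apply: (iff_trans (colona g)); split=> /IE.
exists 'X_[a]; split.
  rewrite dhomogX /= (mdeg_pair a ij) ai aj (eq_bigr (fun=> n - n.-1./2)%N).
    rewrite sum_nat_const card_pairC // /vnum; apply/eqP; lia.
  by move=> k; rewrite in_setC => /ak.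
exists (var_pow [set i; j] 1); split=> //; split; first exact: var_pow_prime.
by exists 'X_[a].
Qed.

Lemma vnumE n : (2 <= m)%N -> (0 < n)%N ->
  (vnum n)%:R = (if odd n then m%:R / 2 * n%:R + m%:R / 2 - 2
                 else m%:R / 2 * n%:R + m%:R - 3) :> rat.
Proof.
move=> m2 n0.
(* Here [n] is [2 k + 1] or [2 k + 2] according to parity. *)
have [k [nk nE]] : exists k, n.-1./2 = k /\ n = (k.*2 + (~~ odd n).+1)%N.
  by exists n.-1./2; split=> //; lia.
rewrite /vnum nk; have -> : m%:R = (m - 2)%:R + 2 :> rat by rewrite -natrD subnK.
move: (m - 2)%N => l; case: (odd n) nE => -> /=.
  have -> : ((k.*2 + 1).-1 + l * (k.*2 + 1 - k) = 2 * k + l * k.+1)%N by lia.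
  by rewrite -muln2 !(natrD, natrM, mulrSr); field.
have -> : ((k.*2 + 2).-1 + l * (k.*2 + 2 - k) = 2 * k + 1 + l * (k + 2))%N by lia.
by rewrite -muln2 !(natrD, natrM, mulrSr); field.
Qed.

End VNumber.

(** * Minimal resolutions from trees of monomial relations *)

Section TreeResolution.

Variables (K : fieldType) (m M : nat).
Local Notation R := {mpoly K[m]}.

Variables (G : 'I_M.+1 -> 'X_{1..m}) (x : 'I_M -> 'I_m).
Variables (par : 'I_M -> 'I_M.+1) (d : 'I_M -> 'X_{1..m}).

Local Notation src a := (widen_ord (leqnSn M) a).

(** Edges run from each generator but the last, the root, to a later one. By [G_exp], a multiple of
    the generator at [a] lying in the span of the later ones needs a coefficient divisible by
    ['X_(x a)]. *)
Hypothesis par_gt : forall a : 'I_M, (a < par a)%N.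
Hypothesis G_rel : forall a, (U_(x a) + G (src a))%MM = (d a + G (par a))%MM.
Hypothesis G_exp : forall (a : 'I_M) (b : 'I_M.+1), (a < b)%N ->
  (G (src a) (x a) < G b (x a))%N.

Definition gen_col : 'cV[R]_M.+1 := \col_b 'X_[G b].

Definition syz_mx : 'M[R]_(M, M.+1) := \matrix_(a, b)
  if b == src a then 'X_(x a) else if b == par a then - 'X_[d a] else 0.

Lemma par_neq a : (par a == src a) = false.
Proof. by apply/negbTE; rewrite -val_eqE /= gtn_eqF. Qed.

Lemma syz_mx_lt (a : 'I_M) (b : 'I_M.+1) : (b < a)%N -> syz_mx a b = 0.
Proof.
move=> ba; rewrite mxE -!val_eqE /= ltn_eqF // ltn_eqF //.
exact: ltn_trans ba (par_gt a).
Qed.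

Lemma syz_mx_diag a : syz_mx a (src a) = 'X_(x a).
Proof. by rewrite mxE eqxx. Qed.

Lemma syz_mx_gen_col : syz_mx *m gen_col = 0.
Proof.
apply/matrixP => a l; rewrite !mxE (bigD1 (src a)) //= (bigD1 (par a)) ?par_neq //=.
rewrite !mxE !eqxx par_neq big1 ?addr0 => [|b /andP[/negbTE bs /negbTE bp]].
  by rewrite mulNr -!mpolyXD G_rel subrr.
by rewrite mxE bs bp mul0r.
Qed.

(** Forward substitution: rows after [a] vanish in column [src a], whose diagonal entry is a
    variable. *)
Lemma mulmx_syz_inj (w : 'rV[R]_M) : w *m syz_mx = 0 -> w = 0.
Proof.
move=> wD; suff w0 t (a : 'I_M) : (a < t)%N -> w 0 a = 0.
  by apply/rowP => a; rewrite (w0 M) // mxE.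
elim: t a => // t IHt a at1.
have := congr1 (fun A : 'rV[R]_M.+1 => A 0 (src a)) wD; rewrite !mxE (bigD1 a) //=.
rewrite big1 ?addr0 => [|c ca]; last first.
  have [lt_ca|lt_ac|/val_inj e] := ltngtP c a.
  - by rewrite IHt ?mul0r //; lia.
  - by rewrite syz_mx_lt // mulr0.
  - by rewrite e eqxx in ca.
rewrite syz_mx_diag => /eqP; rewrite mulf_eq0 => /orP[/eqP//|].
by rewrite -msupp_eq0 msuppX.
Qed.

(* The ideal quotient of [(G b | b > a)] by [G a] is generated by the variable
   [x a], so the first nonzero coordinate of a syzygy can be cleared with the
   corresponding row of [syz_mx]. *)
Lemma syzygies_gen_col (v : 'rV[R]_M.+1) :
  v *m gen_col = 0 -> exists w, v = w *m syz_mx.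
Proof.
move=> vG.
have clear t : (t <= M)%N -> exists w, forall b : 'I_M.+1, (b < t)%N ->
    (v - w *m syz_mx) 0 b = 0.
  elim: t => [|t IHt] tM; first by exists 0.
  have [w w0] := IHt (ltnW tM); pose a := Ordinal tM; pose v' := v - w *m syz_mx.
  have v'G : v' *m gen_col = 0.
    by rewrite mulmxBl vG -mulmxA syz_mx_gen_col mulmx0 subr0.
  (* Earlier coordinates are zero, so this term is minus a combination of later generators, all of
     higher exponent at [x a]. *)
  have : var_pow [set x a] (G (src a) (x a)).+1 (v' 0 (src a) * 'X_[G (src a)]).
    have := congr1 (fun A : 'M[R]_1 => A 0 0) v'G.
    rewrite [LHS]mxE [RHS]mxE (bigD1 (src a)) //=.
    move/eqP; rewrite addr_eq0 [gen_col (src a) 0]mxE => /eqP->; rewrite var_powN.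
    rewrite big_mkcond; apply: (ideal_sum _ (var_pow_is_ideal K _ _)) => b.
    have [Z _ _] := var_pow_is_ideal K [set x a] (G (src a) (x a)).+1.
    have [bs|bs|e] := ltngtP b a; last first.
    - by have /val_inj-> : val b = val (src a) by []; rewrite eqxx; exact: Z.
    - case: ifP => _; last exact: Z.
      rewrite [gen_col b 0]mxE var_powMX wt1.
      by have /eqP-> : (_ == 0)%N := G_exp bs; apply: var_pow0.
    - by rewrite w0 // mul0r if_same; exact: Z.
  rewrite var_powMX wt1 subSnn => /var_pow_one v'x.
  have [c v'c] : exists c, v' 0 (src a) = c * 'X_(x a).
    apply: (v'x (fun f => exists c, f = c * 'X_(x a))) => [|k].
      split=> [|_ _ [c ->] [e ->]|f _ [c ->]]; first by exists 0; rewrite mul0r.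
        by exists (c + e); rewrite mulrDl.
      by exists (f * c); rewrite mulrA.
    by rewrite inE => /eqP->; exists 1; rewrite mul1r.
  (* Row [a] vanishes before its diagonal entry, so subtracting [c] times it kills coordinate [a]
     and keeps the earlier zeros. *)
  exists (w + c *: delta_mx 0 a) => b bt.
  rewrite mulmxDl opprD addrA -/v' -scalemxAl -rowE [LHS]mxE.
  rewrite [(- _ : 'rV_M.+1) 0 b]mxE [(c *: _ : 'rV_M.+1) 0 b]mxE [row _ _ 0 b]mxE.
  move: bt; rewrite ltnS leq_eqVlt => /orP[/eqP bt|bt].
    have -> : b = src a by apply: val_inj.
    by rewrite syz_mx_diag v'c subrr.
  by rewrite w0 // syz_mx_lt // mulr0 subr0.
have [w w0] := clear M (leqnn M); exists w; apply/eqP; rewrite -subr_eq0.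
apply/eqP/rowP => b; rewrite [RHS]mxE.
have [bM|Mb] := ltnP b M; first exact: w0.
have {Mb} -> : b = ord_max by apply: val_inj => /=; have := ltn_ord b; lia.
have v'G : (v - w *m syz_mx) *m gen_col = 0.
  by rewrite mulmxBl vG -mulmxA syz_mx_gen_col mulmx0 subr0.
have := congr1 (fun A : 'M[R]_1 => A 0 0) v'G.
rewrite [LHS]mxE [RHS]mxE (bigD1 ord_max) //=.
rewrite big1 ?addr0 => [|c cM]; last first.
  rewrite w0 ?mul0r //; move: cM; rewrite -val_eqE /=; have := ltn_ord c; lia.
rewrite [gen_col _ _]mxE => /eqP.
rewrite mulf_eq0 -[X in _ || X]msupp_eq0 msuppX orbF.
by move=> /eqP.
Qed.

Definition tree_rk (i : nat) : nat :=
  match i with 0 => 1 | 1 => M.+1 | 2 => M | _ => 0 end.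

(** A relation has the degree of its source generator plus one, its coefficient there being a
    variable. *)
Definition tree_shift (i : nat) : 'I_(tree_rk i) -> int :=
  match i with
  | 0 => fun=> 0
  | 1 => fun b => (mdeg (G b))%:Z
  | 2 => fun a => (mdeg (G (src a))).+1%:Z
  | _ => fun=> 0
  end.

Definition tree_diff (i : nat) : 'M[R]_(tree_rk i.+1, tree_rk i) :=
  match i with 0 => gen_col | 1 => syz_mx | _ => 0 end.

Definition tree_seq : free_seq K m := @FreeSeq K m tree_rk tree_shift tree_diff 1%:M.

Lemma irrelevantX (u : 'X_{1..m}) : u != 0%MM -> irrelevant_ideal ('X_[u] : R).
Proof.
move=> u0; have [k uk] : exists k, u k != 0%N.
  apply/existsP; apply: contraR u0; rewrite negb_exists => /forallP u0.
  by apply/eqP/mnmP => k; rewrite mnm0E; apply/eqP; have := u0 k; rewrite negbK.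
have ku : (U_(k) <= u)%MM by rewrite lep1mP.
rewrite -(submK ku) mpolyXD.
have [_ _ M'] := gen_ideal_is_ideal (fun g : R => exists i, g = 'X_i).
by apply: M'; apply: gen_ideal_gen; exists k.
Qed.

Lemma homog_of_degreeX (e : int) (u : 'X_{1..m}) :
  e = (mdeg u)%:Z -> homog_of_degree e ('X_[u] : R).
Proof. by right; exists (mdeg u); rewrite // dhomogX /=. Qed.

Lemma tree_min_resolution (I : R -> Prop) :
  (forall f, I f <-> exists v : 'rV[R]_M.+1, f = (v *m gen_col) 0 0) ->
  (forall b, G b != 0%MM) -> (forall a, d a != 0%MM) ->
  min_graded_free_resolution tree_seq I.
Proof.
move=> IG G0 d0; split; [split|split|] => /=.
- by move=> l; rewrite mxE !ord1; right; exists 0%N => //; apply: dhomog1.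
- move=> [|[|[|i]]] k l /=.
  + by rewrite mxE subr0; apply: homog_of_degreeX.
  + rewrite mxE; case: eqP => [->|_].
      by apply: homog_of_degreeX; rewrite mdeg1; lia.
    case: eqP => [->|_]; last by left.
    have := congr1 mdeg (G_rel k); rewrite !mdegD mdeg1 => e.
    have [->|[e' de dh]] := @homog_of_degreeX
      ((mdeg (G (src k))).+1%:Z - (mdeg (G (par k)))%:Z) (d k) ltac:(lia).
      by left; rewrite oppr0.
    by right; exists e' => //; rewrite rpredN.
  + by case: k.
  + by case: k.
- move=> r; exists (const_mx r); rewrite mulmx1 mxE subrr; apply/IG.
  by exists 0; rewrite mul0mx mxE.
- move=> v; rewrite mulmx1; apply: (iff_trans (IG _)).
  split=> -[w e]; exists w; last by rewrite e.
  by apply/matrixP => i j; rewrite !ord1.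
- move=> [|[|i]] v /=.
  + split=> [/syzygies_gen_col//|[w ->]].
    by rewrite -mulmxA syz_mx_gen_col mulmx0.
  + split=> [/mulmx_syz_inj->|[w ->]]; first by exists 0; rewrite mul0mx.
    by rewrite mulmx0 mul0mx.
  + split=> [_|[w ->]]; last exact: mulmx0.
    by exists 0; apply/rowP => -[].
- move=> [|[|[|i]]] k l /=; rewrite ?[gen_col _ _]mxE ?[syz_mx _ _]mxE.
  + exact: irrelevantX.
  + case: eqP => _; first by apply: irrelevantX; rewrite -mdeg_eq0 mdeg1.
    have [Z _ M'] := gen_ideal_is_ideal (fun g : R => exists i, g = 'X_i).
    case: eqP => _; last exact: Z.
    by rewrite -mulN1r; apply: M'; apply: irrelevantX.
  + by case: k.
  + by case: k.
Qed.

(** A relation has one degree more than its source but sits one step further, so it contributes the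
    same as its source generator; the generators decide. *)
Lemma tree_regularity (I : R -> Prop) top :
  (forall f, I f <-> exists v : 'rV[R]_M.+1, f = (v *m gen_col) 0 0) ->
  (forall b, G b != 0%MM) -> (forall a, d a != 0%MM) ->
  (forall b, mdeg (G b) <= mdeg (G top))%N ->
  is_regularity_quot I ((mdeg (G top))%:Z - 1).
Proof.
move=> IG G0 d0 Gtop; exists tree_seq; split; first exact: tree_min_resolution.
have top0 : (0 < mdeg (G top))%N by rewrite lt0n mdeg_eq0.
split=> [|i j].
  exists 1%N, (mdeg (G top))%:Z; split=> //; apply/eqP; rewrite -lt0n.
  by apply/card_gt0P; exists top; rewrite inE.
move/eqP; rewrite -lt0n => /card_gt0P[k]; rewrite inE => /eqP<- {j}.
case: i k => [|[|[|i]]] k /=.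
- by lia.
- by have := Gtop k; lia.
- by have := Gtop (src k); lia.
- by case: k.
Qed.

End TreeResolution.

(** * Generators of the symbolic power and their tree *)

Section Generators.

Variables (K : fieldType) (m n : nat).
Hypotheses (m1 : (1 < m)%N) (n0 : (0 < n)%N).
Local Notation R := {mpoly K[m]}.

Let m0 : (0 < m)%N := ltnW m1.

(** One less than the number of generators: each [t] with [2 t < n] gives [m] of them, and for even
    [n] the [m] monomials with [2 t = n] coincide and give one more. *)
Definition nrels : nat := (m * uphalf n - odd n)%N.

(* With [b = t * m + i] and [i < m], this is the monomial
   [x_i ^ t * \prod_(k != i) x_k ^ (n - t)]. *)
Definition gen_exp (b : nat) : 'X_{1..m} :=
  [multinom if (k : nat) == b %% m then b %/ m else n - b %/ m | k < m]%N.

Lemma gen_expE b k :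
  gen_exp b k = (if k == b %% m :> nat then b %/ m else n - b %/ m)%N.
Proof. by rewrite mnmE. Qed.

Lemma quot_ltn a : (a < nrels)%N -> ((a %/ m).*2 < n)%N.
Proof.
move=> an; have : (a %/ m < uphalf n)%N.
  by rewrite ltn_divLR // mulnC; apply: leq_trans an (leq_subr _ _).
by lia.
Qed.

Lemma quot_leq b : (b <= nrels)%N -> ((b %/ m).*2 <= n)%N.
Proof.
rewrite leq_eqVlt => /orP[/eqP->|/quot_ltn/ltnW//]; rewrite /nrels.
have [on|en] := boolP (odd n); last by rewrite subn0 mulKn //; lia.
have : ((m * uphalf n - 1) %/ m < uphalf n)%N.
  have : (0 < m * uphalf n)%N by rewrite muln_gt0 m0; lia.
  by rewrite ltn_divLR // [(uphalf n * m)%N]mulnC; lia.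
by rewrite /=; lia.
Qed.

(** The last generator has [t = n./2], so its exponents are [n./2] or [uphalf n]. *)
Lemma gen_exp_root_le k : (gen_exp nrels k <= uphalf n)%N.
Proof.
rewrite gen_expE; have qn := quot_leq (leqnn nrels).
suff : (n - uphalf n <= nrels %/ m)%N by case: ifP => _; lia.
rewrite leq_divRL // /nrels; have [on|en] := boolP (odd n) => /=.
  have -> : (n - uphalf n = (uphalf n).-1)%N by lia.
  have : (0 < uphalf n)%N by lia.
  by case: (uphalf n) => // h _ /=; rewrite mulnS mulnC; lia.
by rewrite subn0 mulnC leq_mul2l; apply/orP; right; lia.
Qed.

Lemma gen_exp_root_odd (k : 'I_m) :
  odd n -> k = m.-1 :> nat -> gen_exp nrels k = n./2.
Proof.
move=> on km; rewrite gen_expE.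
have -> : nrels = (n./2 * m + m.-1)%N.
  rewrite /nrels on; have -> : uphalf n = n./2.+1 by lia.
  by rewrite mulnS mulnC; lia.
have mm : (m.-1 < m)%N by lia.
by rewrite modnMDl modn_small // divnMDl // divn_small // addn0 km eqxx.
Qed.

(** The parent of [a] keeps the distinguished variable and raises [t] by one, or is the root when
    [a + m] overshoots. The first part makes the relation exist, the second makes its coefficient
    nonconstant. *)
Lemma gen_exp_next a : (a < nrels)%N ->
  (forall k : 'I_m, gen_exp (minn (a + m) nrels) k <= (a %% m == k) + gen_exp a k)%N
  /\ exists k : 'I_m,
    (gen_exp (minn (a + m) nrels) k < (a %% m == k) + gen_exp a k)%N.
Proof.
move=> an; have qn := quot_ltn an.
have [k0 k0a] : exists k : 'I_m, (k == a %% m :> nat)%N = false.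
  have [e|e] := eqVneq (a %% m)%N 0%N; [exists (Ordinal m1)|exists (Ordinal m0)].
    by rewrite e.
  by rewrite eq_sym; apply/negbTE.
have [le_am|lt_na] := leqP (a + m) nrels.
  split=> [k|]; last first.
    by exists k0; rewrite !gen_expE modnDr divnDr // divnn m0 k0a; lia.
  by rewrite !gen_expE modnDr divnDr // divnn m0 eq_sym; case: eqP => _ /=; lia.
have rm := ltn_pmod a m0; have aE := divn_eq a m.
(* Overshooting the root forces [a] onto the last level with [2 t < n]. *)
have hq : uphalf n = (a %/ m).+1.
  apply/eqP; rewrite eqn_leq; apply/andP; split; last by lia.
  rewrite -ltnS -(ltn_pmul2l m0) !mulnS; rewrite [(m * (_ %/ _))%N]mulnC.
  by move: lt_na; rewrite /nrels; case: (odd n) => /=; lia.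
split=> [k|].
  have := gen_exp_root_le k; rewrite (gen_expE a).
  rewrite [(k == _ :> nat)%N]eq_sym; case: eqP => _ /=; lia.
(* For even [n] the strict drop occurs at [k0]; for odd [n] it occurs only at [m.-1], the
   distinguished variable of the root. *)
have [on|en] := boolP (odd n); last first.
  by exists k0; have := gen_exp_root_le k0; rewrite (gen_expE a) k0a eq_sym k0a; lia.
have lt_m : (m.-1 < m)%N by lia.
exists (Ordinal lt_m); rewrite gen_exp_root_odd // gen_expE eq_sym.
by case: eqP => _ /=; lia.
Qed.

Definition gen_mon (b : 'I_nrels.+1) : 'X_{1..m} := gen_exp b.
Definition rel_var (a : 'I_nrels) : 'I_m := Ordinal (ltn_pmod a m0).
Definition rel_par (a : 'I_nrels) : 'I_nrels.+1 := inord (minn (a + m) nrels).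
Definition rel_coef (a : 'I_nrels) : 'X_{1..m} :=
  (U_(rel_var a) + gen_exp a - gen_mon (rel_par a))%MM.

Lemma rel_parE a : rel_par a = minn (a + m) nrels :> nat.
Proof. by rewrite inordK // ltnS geq_minr. Qed.

Lemma rel_par_gt (a : 'I_nrels) : (a < rel_par a)%N.
Proof. by rewrite rel_parE leq_min ltn_ord andbT -addn1 leq_add2l. Qed.

Lemma gen_mon_rel (a : 'I_nrels) :
  (U_(rel_var a) + gen_mon (widen_ord (leqnSn nrels) a))%MM
  = (rel_coef a + gen_mon (rel_par a))%MM.
Proof.
rewrite submK //; apply/mnm_lepP => k; rewrite mnmDE mnm1E /gen_mon rel_parE.
by have [H _] := gen_exp_next (ltn_ord a); apply: H.
Qed.

Lemma rel_coef_neq0 a : rel_coef a != 0%MM.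
Proof.
have [_ [k]] := gen_exp_next (ltn_ord a); apply: contraTneq => /mnmP/(_ k).
by rewrite mnmBE mnmDE mnm1E mnm0E /gen_mon rel_parE -leqNgt => /eqP.
Qed.

(** The left exponent is [t]. A later generator with the same distinguished variable has larger [t];
    any other has exponent [n - t'] there, above [t] since [2 t < n] and [2 t' <= n]. *)
Lemma gen_mon_exp (a : 'I_nrels) (b : 'I_nrels.+1) : (a < b)%N ->
  (gen_mon (widen_ord (leqnSn nrels) a) (rel_var a) < gen_mon b (rel_var a))%N.
Proof.
move=> ab; rewrite /gen_mon !gen_expE /= eqxx.
have qa := quot_ltn (ltn_ord a); have qb := quot_leq (ltn_ord b : b <= nrels)%N.
case: eqP => [e|_]; last by lia.
have := divn_eq a m; have := divn_eq b m; rewrite -e => bE aE.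
by rewrite -(ltn_pmul2r m0); lia.
Qed.

Lemma mdeg_gen_mon b : mdeg (gen_mon b) = (b %/ m + m.-1 * (n - b %/ m))%N.
Proof.
rewrite mdegE (bigD1 (Ordinal (ltn_pmod b m0))) //= /gen_mon gen_expE eqxx.
congr addn.
rewrite (eq_bigr (fun=> n - b %/ m)%N) => [|k]; last first.
  by rewrite gen_expE -val_eqE /= => /negbTE->.
by rewrite sum_nat_const cardC1 card_ord.
Qed.

Lemma mdeg_gen_mon0 : mdeg (gen_mon ord0) = (n * m.-1)%N.
Proof. by rewrite mdeg_gen_mon div0n subn0 mulnC. Qed.

Lemma gen_mon_neq0 b : gen_mon b != 0%MM.
Proof.
have qb := quot_leq (ltn_ord b : b <= nrels)%N.
rewrite -mdeg_eq0 mdeg_gen_mon addn_eq0 muln_eq0; lia.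
Qed.

Lemma mdeg_gen_mon_le b : (mdeg (gen_mon b) <= mdeg (gen_mon ord0))%N.
Proof.
have qb := quot_leq (ltn_ord b : b <= nrels)%N; rewrite mdeg_gen_mon0 mdeg_gen_mon.
have le_q : (b %/ m <= m.-1 * (b %/ m))%N by rewrite leq_pmull //; lia.
have le_qn : (m.-1 * (b %/ m) <= m.-1 * n)%N by rewrite leq_mul2l; lia.
by rewrite mulnBr [(n * _)%N]mulnC; lia.
Qed.

Lemma gen_mon_sym_pow b : sym_pow n ('X_[gen_mon b] : R).
Proof.
have qb := quot_leq (ltn_ord b : b <= nrels)%N.
apply/sym_powX => p q pq; rewrite /gen_mon !gen_expE.
case: eqP => [ep|_]; case: eqP => [eq|_]; try by lia.
by case/eqP: pq; apply: val_inj; rewrite /= ep.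
Qed.

Lemma gen_mon_min u : sym_pow n ('X_[u] : R) -> exists b, (gen_mon b <= u)%MM.
Proof.
(* The least exponent [u i] selects the divisor: the root if it is at least [uphalf n], otherwise
   the generator with [t = u i] at [i], as all other exponents are at least [n - u i]. *)
move/sym_powX => un; pose i := [arg min_(k < Ordinal m0) u k]%N.
have ui k : (u i <= u k)%N by rewrite /i; case: arg_minnP => // j _; apply.
have [hu|uh] := leqP (uphalf n) (u i).
  exists ord_max; apply/mnm_lepP => k; apply: leq_trans (ui k).
  exact: leq_trans (gen_exp_root_le k) hu.
have lt_b : (u i * m + i < nrels.+1)%N.
  have : (u i * m + m <= m * uphalf n)%N by rewrite -mulSnr mulnC leq_mul2l uh orbT.
  by have := ltn_ord i; rewrite /nrels; case: (odd n) => /=; lia.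
exists (Ordinal lt_b); apply/mnm_lepP => k; rewrite /gen_mon gen_expE /=.
rewrite modnMDl modn_small // divnMDl // divn_small // addn0.
case: eqP => [e|ki]; first by have -> : k = i by apply: val_inj.
have /un : i != k by apply/eqP => e; apply: ki; rewrite e.
by lia.
Qed.

Lemma sym_pow_gen (I : R -> Prop) : (forall f, I f <-> sym_pow n f) ->
  forall f, I f <-> exists v : 'rV[R]_nrels.+1, f = (v *m gen_col K gen_mon) 0 0.
Proof.
move=> IE f; apply: (iff_trans (IE f)); split=> [fn|[v ->]]; last first.
  rewrite mxE; apply: (ideal_sum _ (sym_pow_is_ideal K m n)) => b.
  have [_ _ M] := sym_pow_is_ideal K m n; apply: M; rewrite mxE.
  exact: gen_mon_sym_pow.
pose Q (g : R) := exists v : 'rV[R]_nrels.+1, g = (v *m gen_col K gen_mon) 0 0.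
apply: (@ideal_msupp _ _ Q) => [|u uf].
  split=> [|_ _ [v ->] [w ->]|g _ [v ->]]; first by exists 0; rewrite mul0mx mxE.
    by exists (v + w); rewrite mulmxDl [RHS]mxE.
  by exists (g *: v); rewrite -scalemxAl [RHS]mxE.
have [b bu] := gen_mon_min (sym_pow_msupp fn uf).
exists ('X_[u - gen_mon b] *: delta_mx 0 b).
by rewrite -scalemxAl -rowE !mxE -mpolyXD submK.
Qed.

Lemma sym_pow_regularity (I : R -> Prop) : (forall f, I f <-> sym_pow n f) ->
  is_regularity_quot I (n%:Z * (m%:Z - 1) - 1).
Proof.
move=> IE; have -> : n%:Z * (m%:Z - 1) - 1 = (mdeg (gen_mon ord0))%:Z - 1.
  rewrite mdeg_gen_mon0 PoszM; congr (_ * _ - _); lia.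
apply: (tree_regularity (x := rel_var) (par := rel_par) (d := rel_coef)).
- exact: rel_par_gt.
- exact: gen_mon_rel.
- exact: gen_mon_exp.
- exact: sym_pow_gen.
- exact: gen_mon_neq0.
- exact: rel_coef_neq0.
- exact: mdeg_gen_mon_le.
Qed.

End Generators.

(** * The v-number compared with the regularity *)

Theorem theorem4p5 (K : fieldType) (m : nat) (hm : (3 <= m)%N) :
  let J : {mpoly K[m]} -> Prop := cover_ideal (complete_graph m) in
  [/\ forall n : nat, (1 <= n)%N ->
        exists2 v : nat, is_vnumber (symbolic_power J n) v &
          v%:R = (if odd n then m%:R / 2 * n%:R + m%:R / 2 - 2
                  else m%:R / 2 * n%:R + m%:R - 3) :> rat,
      forall n : nat, (1 <= n)%N ->
        exists (v : nat) (r : int),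
          [/\ is_vnumber (symbolic_power J n) v,
              is_regularity_quot (symbolic_power J n) r,
              v%:Z <= r & r = n%:Z * (m%:Z - 1) - 1]
    & forall i : nat, i = 1%N \/ i = 2%N ->
        exists (v : nat) (r : int),
          [/\ is_vnumber (symbolic_power J i) v,
              is_regularity_quot (symbolic_power J i) r & r = v%:Z]].
Proof.
move=> J; have m2 : (2 <= m)%N := ltnW hm.
have vP n : (1 <= n)%N -> is_vnumber (symbolic_power J n) (vnum m n).
  move=> n1; split=> [|w]; first exact: v_witness_vnum (symbolic_power_complete _).
  exact: v_witness_ge (symbolic_power_complete _).
have rP n : (1 <= n)%N ->
    is_regularity_quot (symbolic_power J n) (n%:Z * (m%:Z - 1) - 1).
  by move=> n1; apply: sym_pow_regularity => //; apply: symbolic_power_complete.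
split=> [n n1|n n1|i i12].
- by exists (vnum m n); [exact: vP | exact: vnumE].
- exists (vnum m n), (n%:Z * (m%:Z - 1) - 1); split=> //; [exact: vP | exact: rP |].
  have -> : n%:Z * (m%:Z - 1) - 1 = (n * m.-1 - 1)%N%:Z.
    have : (0 < n * m.-1)%N by rewrite muln_gt0; lia.
    have -> : m%:Z - 1 = m.-1%:Z by lia.
    by rewrite -PoszM; lia.
  (* The right side is [n - 1 + (m - 2) * n], so the bound amounts to dropping the subtracted
     [n.-1./2]. *)
  rewrite lez_nat /vnum; have -> : m.-1 = (m - 2).+1 by lia.
  have : ((m - 2) * (n - n.-1./2) <= (m - 2) * n)%N.
    by rewrite leq_mul2l leq_subr orbT.
  by rewrite mulnS mulnC; lia.
- have i1 : (1 <= i)%N by case: i12 => ->.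
  exists (vnum m i), (i%:Z * (m%:Z - 1) - 1); split; [exact: vP | exact: rP |].
  (* For both values [i.-1./2] is zero, so nothing is lost in that bound. *)
  by case: i12 => ->; rewrite /vnum /= ?subn0; lia.
Qed.
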